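(* Let $M$ be a semilattice and $\mathcal{A}\in\mathcal{H}(M)$. Then $\mathsf{D}^0(M,\mathcal{A})=0$ and $\mathsf{D}^1(M,\mathcal{A})=0$. In particular, every coextension $0\to\mathcal{A}\to N\xrightarrow{\pi}M\to0$ splits uniquely.
   Context: A semilattice is a commutative monoid $M$ (written multiplicatively, unit $1$) with $m^2=m$ for all $m\in M$. A system of abelian groups $\mathcal{A}\in\mathcal{H}(M)$ over a commutative monoid $M$ consists of an abelian group $\mathcal{A}(a)$ for each $a\in M$ and homomorphisms $r_*:\mathcal{A}(a)\to\mathcal{A}(ra)$ for all $r,a\in M$ with $1_*=\mathrm{id}$ and $(rs)_*=r_*\circ s_*$. $\mathsf{C}^0(M,\mathcal{A})$ is the group of functions $g$ with $g(a)\in\mathcal{A}(a)$; $\mathsf{C}^1(M,\mathcal{A})$ the group of functions $f$ with $f(a,b)\in\mathcal{A}(ab)$, $f(a,b)=f(b,a)$; $\mathsf{C}^2(M,\mathcal{A})$ the group of functions $h$ with $h(a,b,c)\in\mathcal{A}(abc)$, $h(a,b,c)-h(b,a,c)+h(b,c,a)=0$. The coboundaries are $$(\partial^0g)(a,b)=a_*g(b)-g(ab)+b_*g(a),\qquad(\partial^1f)(a,b,c)=a_*f(b,c)-f(ab,c)+f(a,bc)-c_*f(a,b).$$ $\mathsf{D}^0(M,\mathcal{A})=\ker\partial^0$ and $\mathsf{D}^1(M,\mathcal{A})=\ker\partial^1/\mathrm{im}\,\partial^0$. A coextension $0\to\mathcal{A}\to N\xrightarrow{\pi}M\to0$ is a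 surjective homomorphism of commutative monoids $\pi:N\to M$ with an action $\bullet$ of the group $\mathcal{A}(m)$ on $\pi^{-1}(m)$ for each $m\in M$ such that (i) for $n,n'\in\pi^{-1}(m)$ there is a unique $x\in\mathcal{A}(m)$ with $n'=x\bullet n$; (ii) $(x\bullet n)(y\bullet n')=(m'_*(x)+m_*(y))\bullet(nn')$ for $x\in\mathcal{A}(m)$, $n\in\pi^{-1}(m)$, $y\in\mathcal{A}(m')$, $n'\in\pi^{-1}(m')$. A splitting is a monoid homomorphism $\mu:M\to N$ with $\pi\mu=\mathrm{id}_M$; the coextension splits uniquely if there is exactly one splitting. *)

(* Defs.v *)
From HB Require Import structures.
From mathcomp Require Import all_boot all_algebra.
From mathcomp Require Import boolp.

Set Implicit Arguments.
Unset Strict Implicit.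
Unset Printing Implicit Defensive.

Import GRing.Theory.
Local Open Scope ring_scope.

HB.mixin Record Monoid_isCommutative M of monoid.Monoid M := {
  mulgC : commutative (@monoid.mul M)
}.

#[short(type="comMonoidType")]
HB.structure Definition ComMonoid :=
  {M of Monoid_isCommutative M & monoid.Monoid M}.

HB.mixin Record ComMonoid_isIdempotent M of ComMonoid M := {
  mulgg : idempotent_op (@monoid.mul M)
}.

#[short(type="semilatticeType")]
HB.structure Definition Semilattice :=
  {M of ComMonoid_isIdempotent M & ComMonoid M}.

Lemma mulgCA (M : comMonoidType) (a b c : M) : (b * a * c = a * b * c)%g.
Proof. by rewrite (mulgC b a). Qed.

Lemma mulgCrot (M : comMonoidType) (a b c : M) : (b * c * a = a * b * c)%g.
Proof. by rewrite mulgC mulgA. Qed.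

Section Cast.
Variables (M : eqType) (A : M -> zmodType).

(* Identifies A a with A b; the proof of a = b is irrelevant by cast_irr. *)
Definition cast (a b : M) (e : a = b) (x : A a) : A b := eq_rect a A x b e.

Lemma cast_id a (e : a = a) x : cast e x = x.
Proof. by rewrite (eq_irrelevance e erefl). Qed.

Lemma castK a b (e : a = b) (e' : b = a) x : cast e' (cast e x) = x.
Proof. by case: b / e e' => e'; rewrite !cast_id. Qed.

Lemma cast_trans a b c (e : a = b) (e' : b = c) (e'' : a = c) x :
  cast e' (cast e x) = cast e'' x.
Proof. by case: b / e e' => e'; congr (cast _ x); apply: eq_irrelevance. Qed.

Lemma cast_comp a b c (e : a = b) (e' : b = c) x :
  cast e' (cast e x) = cast (etrans e e') x.
Proof. exact: cast_trans. Qed.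

Lemma cast_irr a b (e e' : a = b) x : cast e x = cast e' x.
Proof. by rewrite (eq_irrelevance e e'). Qed.

Lemma cast_is_zmod_morphism a b (e : a = b) : zmod_morphism (cast e).
Proof. by case: b / e. Qed.

HB.instance Definition _ a b (e : a = b) :=
  GRing.isZmodMorphism.Build (A a) (A b) (cast e) (cast_is_zmod_morphism e).

Lemma castB a b (e : a = b) x y : cast e (x - y) = cast e x - cast e y.
Proof. exact: raddfB. Qed.

Lemma castD a b (e : a = b) x y : cast e (x + y) = cast e x + cast e y.
Proof. exact: raddfD. Qed.
End Cast.

(* push r a is the homomorphism r_* : A(a) -> A(ra). *)
Record system (M : comMonoidType) := System {
  sys_group :> M -> zmodType;
  push : forall r a : M, {additive sys_group a -> sys_group (r * a)%g};
  push1 : forall (a : M) (x : sys_group a), cast (mul1g a) (push 1%g a x) = x;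
  pushM : forall (r s a : M) (x : sys_group a),
    push (r * s)%g a x = cast (mulgA r s a) (push r (s * a)%g (push s a x))
}.

Lemma pushB (M : comMonoidType) (A : system M) (r a : M) (x y : A a) :
  push A r a (x - y) = push A r a x - push A r a y.
Proof. exact: raddfB. Qed.

Lemma pushD (M : comMonoidType) (A : system M) (r a : M) (x y : A a) :
  push A r a (x + y) = push A r a x + push A r a y.
Proof. exact: raddfD. Qed.

Section DependentFunctions.
Variables (I : Type) (F : I -> zmodType).

Definition dfun := forall i, F i.
HB.instance Definition _ := Choice.on dfun.

Implicit Types f g h : dfun.
Definition dfun_zero : dfun := fun=> 0.
Definition dfun_opp f : dfun := fun i => - f i.
Definition dfun_add f g : dfun := fun i => f i + g i.

Lemma dfun_addA : associative dfun_add.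
Proof. by move=> f g h; apply: functional_extensionality_dep => i; exact: addrA. Qed.

Lemma dfun_addC : commutative dfun_add.
Proof. by move=> f g; apply: functional_extensionality_dep => i; exact: addrC. Qed.

Lemma dfun_add0 : left_id dfun_zero dfun_add.
Proof. by move=> f; apply: functional_extensionality_dep => i; exact: add0r. Qed.

Lemma dfun_addN : left_inverse dfun_zero dfun_opp dfun_add.
Proof. by move=> f; apply: functional_extensionality_dep => i; exact: addNr. Qed.

HB.instance Definition _ :=
  GRing.isZmodule.Build dfun dfun_addA dfun_addC dfun_add0 dfun_addN.

Lemma dfun0E i : (0 : dfun) i = 0. Proof. by []. Qed.
Lemma dfunBE f g i : (f - g) i = f i - g i. Proof. by []. Qed.
End DependentFunctions.

Section Kernel.
Variables (U V : zmodType) (f : {additive U -> V}).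

Definition ker_pred : {pred U} := fun x => f x == 0.

Lemma ker_pred_closed : zmod_closed ker_pred.
Proof.
split=> [|x y]; rewrite !unfold_in ?raddf0 // => /eqP fx /eqP fy.
by rewrite raddfB fx fy subr0.
Qed.

HB.instance Definition _ := GRing.isZmodClosed.Build U ker_pred ker_pred_closed.

Record ker := Ker { ker_val :> U; ker_valP : ker_val \in ker_pred }.
HB.instance Definition _ := [isSub for ker_val].
HB.instance Definition _ := [Choice of ker by <:].
HB.instance Definition _ := [SubChoice_isSubZmodule of ker by <:].
End Kernel.

Section Cohomology.
Variables (M : comMonoidType) (A : system M).
Implicit Types a b c : M.

Definition C0 : zmodType := dfun A.

(* Functions f with f(a, b) in A(ab), before imposing symmetry. *)
Definition fun2 : zmodType := dfun (fun a => dfun (fun b => A (a * b)%g)).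

Definition sym_pred : {pred fun2} := fun f =>
  `[< forall a b, f a b = cast (mulgC b a) (f b a) >].

Lemma sym_pred_closed : zmod_closed sym_pred.
Proof.
split=> [|f g]; first by apply/asboolP => a b; rewrite !dfun0E raddf0.
move=> /asboolP fP /asboolP gP; apply/asboolP => a b.
by rewrite !dfunBE castB -fP -gP.
Qed.

HB.instance Definition _ := GRing.isZmodClosed.Build fun2 sym_pred sym_pred_closed.

Record C1 := MkC1 { C1_val : fun2; C1_valP : C1_val \in sym_pred }.
HB.instance Definition _ := [isSub for C1_val].
HB.instance Definition _ := [Choice of C1 by <:].
HB.instance Definition _ := [SubChoice_isSubZmodule of C1 by <:].

Definition C1_fun (f : C1) : forall a b, A (a * b)%g := C1_val f.
Coercion C1_fun : C1 >-> Funclass.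

Lemma C1P (f : C1) a b : f a b = cast (mulgC b a) (f b a).
Proof. by have /asboolP := C1_valP f; apply. Qed.

(* Functions h with h(a, b, c) in A(abc). *)
Definition fun3 : zmodType :=
  dfun (fun a => dfun (fun b => dfun (fun c => A (a * b * c)%g))).

Definition cyc_pred : {pred fun3} := fun h =>
  `[< forall a b c,
      h a b c - cast (mulgCA a b c) (h b a c) + cast (mulgCrot a b c) (h b c a)
      = 0 >].

Lemma cyc_pred_closed : zmod_closed cyc_pred.
Proof.
split=> [|f g]; first by apply/asboolP => a b c; rewrite !dfun0E !raddf0 !addr0.
move=> /asboolP fP /asboolP gP; apply/asboolP => a b c.
have subACA (x y z t : A (a * b * c)%g) : x - y - (z - t) = x - z - (y - t).
  by rewrite !opprB addrACA [in RHS]addrACA [- z - y]addrC.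
rewrite !dfunBE !castB subACA -[RHS]subr0 -{1}(fP a b c) -(gP a b c).
by rewrite [in RHS]opprD addrACA.
Qed.

HB.instance Definition _ := GRing.isZmodClosed.Build fun3 cyc_pred cyc_pred_closed.

Record C2 := MkC2 { C2_val : fun3; C2_valP : C2_val \in cyc_pred }.
HB.instance Definition _ := [isSub for C2_val].
HB.instance Definition _ := [Choice of C2 by <:].
HB.instance Definition _ := [SubChoice_isSubZmodule of C2 by <:].

Lemma push_cast a b b' (e : b = b') (e' : (a * b = a * b')%g) x :
  push A a b' (cast e x) = cast e' (push A a b x).
Proof. by case: b' / e e' => e'; rewrite !cast_id. Qed.

Lemma push_push r s a x :
  push A r (s * a)%g (push A s a x) = cast (esym (mulgA r s a)) (push A (r * s)%g a x).
Proof. by rewrite pushM castK. Qed.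

Lemma pushC r s a x :
  push A (r * s)%g a x = cast (mulgCA r s a) (push A (s * r)%g a x).
Proof. by case: _ / (mulgC s r) (mulgCA r s a) => e; rewrite cast_id. Qed.

Definition d0_fun (g : C0) : fun2 := fun a b =>
  push A a b (g b) - g (a * b)%g + cast (mulgC b a) (push A b a (g a)).

Lemma d0_fun_sym (g : C0) : d0_fun g \in sym_pred.
Proof.
apply/asboolP => a b; rewrite /d0_fun !(castB, castD) castK.
have -> : cast (mulgC b a) (g (b * a)%g) = g (a * b)%g by case: _ / mulgC.
by rewrite addrAC [in RHS]addrAC; congr (_ - _); rewrite addrC.
Qed.

Definition d0 (g : C0) : C1 := MkC1 (d0_fun_sym g).

Lemma d0_is_zmod_morphism : zmod_morphism d0.
Proof.
move=> g h; apply: val_inj.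
apply: functional_extensionality_dep => a; apply: functional_extensionality_dep => b.
rewrite -[RHS]/(d0_fun g a b - d0_fun h a b) /= /d0_fun !dfunBE.
rewrite !pushB castB [in RHS]opprD [RHS]addrACA; congr (_ + _).
by rewrite !opprD addrACA.
Qed.

HB.instance Definition _ := GRing.isZmodMorphism.Build C0 C1 d0 d0_is_zmod_morphism.

Definition d1_fun (f : C1) : fun3 := fun a b c =>
  cast (mulgA a b c) (push A a (b * c)%g (f b c)) - f (a * b)%g c
  + cast (mulgA a b c) (f a (b * c)%g)
  - cast (mulgC c (a * b)%g) (push A c (a * b)%g (f a b)).

Lemma C1_cast (f : C1) a a' b b' (ea : a = a') (eb : b = b')
    (e : (a * b = a' * b')%g) : f a' b' = cast e (f a b).
Proof. by case: a' / ea e; case: b' / eb => e; rewrite cast_id. Qed.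

Lemma d1_fun_cyc (f : C1) : d1_fun f \in cyc_pred.
Proof.
apply/asboolP => a b c; rewrite /d1_fun !(castB, castD).
have fCA : cast (mulgCA a b c) (f (b * a)%g c) = f (a * b)%g c.
  by rewrite (C1_cast f (mulgC b a) erefl (mulgCA a b c)).
have pCA : cast (mulgCA a b c) (cast (mulgC c (b * a)%g) (push A c (b * a)%g (f b a)))
         = cast (mulgC c (a * b)%g) (push A c (a * b)%g (f a b)).
  rewrite (C1P f a b) (push_cast _ (congr1 _ (mulgC b a))).
  by rewrite !cast_comp; apply: cast_irr.
have fb : cast (mulgCrot a b c) (cast (mulgA b c a) (f b (c * a)%g))
        = cast (mulgCA a b c) (cast (mulgA b a c) (f b (a * c)%g)).
  rewrite (C1_cast f erefl (mulgC c a) (congr1 _ (mulgC c a))).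
  by rewrite !cast_comp; apply: cast_irr.
have pb : cast (mulgCrot a b c) (cast (mulgA b c a) (push A b (c * a)%g (f c a)))
        = cast (mulgCA a b c) (cast (mulgA b a c) (push A b (a * c)%g (f a c))).
  rewrite (C1P f a c) (push_cast _ (congr1 _ (mulgC c a))).
  by rewrite !cast_comp; apply: cast_irr.
have fa : cast (mulgCrot a b c) (f (b * c)%g a)
        = cast (mulgA a b c) (f a (b * c)%g).
  by rewrite (C1P f a) (cast_trans _ _ (mulgCrot a b c)).
have pa : cast (mulgCrot a b c) (cast (mulgC a (b * c)%g) (push A a (b * c)%g (f b c)))
        = cast (mulgA a b c) (push A a (b * c)%g (f b c)).
  exact: cast_trans.
rewrite fCA pCA fb pb fa pa.
set p := cast _ (push A a _ _); set q := f _ c; set r := cast _ (f a _).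
set s := cast _ (push A c _ _); set t := cast _ (cast _ (push A b _ _)).
set u := cast _ (cast _ (f b _)).
rewrite opprB subrKA [p - q + r]addrAC [t - q + u]addrAC opprB subrKA.
by rewrite [t - r + u]addrAC -[t + u - r - p]addrA -opprD subrKA [r + p]addrC subrr.
Qed.

Definition d1 (f : C1) : C2 := MkC2 (d1_fun_cyc f).

Lemma d1_is_zmod_morphism : zmod_morphism d1.
Proof.
move=> f g; apply: val_inj.
apply: functional_extensionality_dep => a; apply: functional_extensionality_dep => b.
apply: functional_extensionality_dep => c.
rewrite -[RHS]/(d1_fun f a b c - d1_fun g a b c).
have fgE x y : C1_fun (f - g) x y = f x y - g x y by [].
rewrite /= /d1_fun !fgE !pushB !castB.
have subACA (V : zmodType) (x y z t : V) : x - y - (z - t) = x - z - (y - t).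
  by rewrite !opprB addrACA [in RHS]addrACA [- z - y]addrC.
rewrite [RHS]subACA; congr (_ - _).
by rewrite [in RHS]opprD [RHS]addrACA; congr (_ + _); rewrite subACA.
Qed.

HB.instance Definition _ := GRing.isZmodMorphism.Build C1 C2 d1 d1_is_zmod_morphism.

Lemma d1_d0 (g : C0) : d1 (d0 g) = 0.
Proof.
apply: val_inj.
apply: functional_extensionality_dep => a; apply: functional_extensionality_dep => b.
apply: functional_extensionality_dep => c.
rewrite -[RHS]/(0 : A (a * b * c)%g) /= /d1_fun /C1_fun /= /d0_fun.
rewrite !(pushB, pushD, castB, castD).
have gA : cast (mulgA a b c) (g (a * (b * c))%g) = g (a * b * c)%g by case: _ / mulgA.
have X6 : cast (mulgC c (a * b)%g) (push A c (a * b)%g (cast (mulgC b a) (push A b a (g a))))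
        = cast (mulgA a b c) (cast (mulgC (b * c)%g a) (push A (b * c)%g a (g a))).
  rewrite (push_cast _ (congr1 _ (mulgC b a))) push_push (pushC b c) !cast_comp.
  exact: cast_irr.
have X3 : cast (mulgC c (a * b)%g) (push A c (a * b)%g (push A a b (g b)))
        = cast (mulgA a b c) (push A a (b * c)%g (cast (mulgC c b) (push A c b (g b)))).
  rewrite (push_cast _ (congr1 _ (mulgC c b))) !push_push (pushC a c) !cast_comp.
  exact: cast_irr.
rewrite pushM gA X6 X3.
set x1 := cast _ _; set x2 := cast _ _; set x3 := cast _ _.
set x4 := g _; set x5 := cast _ _; set x6 := cast _ _.
rewrite -addrA addrACA -opprD; apply/eqP; rewrite subr_eq0; apply/eqP.
rewrite [x1 - x2 + x3]addrAC -[x2 - x4 + x6]addrA subrKA addrACA.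
by rewrite -[RHS]addrA [x3 - x5]addrC [x5 + _]addrA [x5 + _]addrA subrr add0r.
Qed.

Definition D0 : zmodType := ker d0.

(* D1 = Z1 / B1; by d1_d0 the whole image of d0 lies in Z1, so B1 is that
   image viewed inside Z1. *)
Definition Z1 : zmodType := ker d1.

Definition B1 : {pred Z1} := fun f => `[< exists g : C0, d0 g = val f >].

Lemma B1_closed : zmod_closed B1.
Proof.
split=> [|f g]; first by apply/asboolP; exists 0; rewrite !raddf0.
move=> /asboolP[u fE] /asboolP[v gE]; apply/asboolP; exists (u - v).
by rewrite !raddfB /= fE gE.
Qed.

HB.instance Definition _ := GRing.isZmodClosed.Build Z1 B1 B1_closed.

Definition D1 : zmodType := Quotient.quot B1.
End Cohomology.

Section Fibers.
Variables (M N : comMonoidType) (p : monoid.UMagmaMorphism.type N M).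

Definition fiber (m : M) := {n : N | p n == m}.

Lemma fiber_mul_proof m m' (u : fiber m) (v : fiber m') :
  p (val u * val v)%g == (m * m')%g.
Proof. by rewrite gmulfM (eqP (valP u)) (eqP (valP v)). Qed.

Definition fiber_mul m m' (u : fiber m) (v : fiber m') : fiber (m * m')%g :=
  exist _ (val u * val v)%g (fiber_mul_proof u v).
End Fibers.

Record coextension (M : comMonoidType) (A : system M) (N : comMonoidType) :=
  Coextension {
    coext_proj : monoid.UMagmaMorphism.type N M;
    coext_surj : forall m, exists n, coext_proj n = m;
    coext_act : forall m, A m -> fiber coext_proj m -> fiber coext_proj m;
    coext_act0 : forall m (n : fiber coext_proj m), coext_act 0 n = n;
    coext_actD : forall m (x y : A m) (n : fiber coext_proj m),
      coext_act (x + y) n = coext_act x (coext_act y n);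
    coext_act_unique : forall m (n n' : fiber coext_proj m),
      exists! x : A m, n' = coext_act x n;
    coext_act_mul : forall m m' (x : A m) (n : fiber coext_proj m)
        (y : A m') (n' : fiber coext_proj m'),
      fiber_mul (coext_act x n) (coext_act y n')
      = coext_act (cast (mulgC m' m) (push A m' m x) + push A m m' y)
          (fiber_mul n n')
  }.

Definition is_splitting (M : comMonoidType) (A : system M) (N : comMonoidType)
    (E : coextension A N) (mu : M -> N) : Prop :=
  monoid.monoid_morphism mu /\ cancel mu (coext_proj E).

Definition splits_uniquely (M : comMonoidType) (A : system M)
    (N : comMonoidType) (E : coextension A N) : Prop :=
  exists! mu : M -> N, is_splitting E mu.

(* Main.v *)
From HB Require Import structures.
Require Import Defs.
From mathcomp Require Import all_boot all_algebra.
From mathcomp Require Import boolp generic_quotient ring_quotient.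

(** In a semilattice the maps [r_*] are idempotent: whenever [rc = c], [r_*] is
    an idempotent endomorphism [R] of [A(c)], because [rr = r]. Hence [2R - 1]
    is an involution, and equations of the form [x = 2Rx + u] have exactly one
    solution ([reflectionK], [doubled_eq0]). All three claims follow from this.

    - A 0-cocycle satisfies [g(a) = 2 a_* g(a)], so it vanishes.

    - Given a 1-cocycle [f], the equations [f(a,a) = 2 a_* g(a) - g(a)] have a
      unique solution [g], so one may subtract a coboundary and assume that
      [f(a,a) = 0] for all [a]. The cocycle identity at [(a,a,b)] now reads
      [f(a,ab) = f(a,b) - a_* f(a,b)]. Substituting this, and the same formula
      with [a] and [b] exchanged, into the identity at [(a,b,ab)] leaves
      [f(a,b) = 2 (ab)_* f(a,b)], so [f = 0] ([normalized_cocycle_eq0]).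

    - Let [n] lie over [a] in a coextension, with [n n = u . n]. Then
      [(x . n)(x . n) = (2 a_* x + u) . n], so exactly one [x] makes [x . n]
      idempotent: every fiber contains a unique idempotent
      ([fiber_idempotent]). Products of idempotents are idempotent, as is [1],
      so these idempotents form a splitting; a homomorphism out of [M] takes
      idempotent values, so there is no other. *)

Import GRing.Theory.
Local Open Scope ring_scope.

Set Implicit Arguments.
Unset Strict Implicit.

Section IdempotentEndomorphism.
Variables (V : zmodType) (R : {additive V -> V}).
Hypothesis R_idem : forall x, R (R x) = R x.

(** When [R] is idempotent, [2R - 1] is minus the identity on its kernel and the
    identity on its image. *)
Definition reflection x := R x + R x - x.

Lemma reflectionK : involutive reflection.
Proof.
by move=> x; rewrite /reflection raddfB raddfD !R_idem addrK subKr.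
Qed.

Lemma doubled_eq0 x : x = R x + R x -> x = 0.
Proof.
move=> xE; rewrite -[x]reflectionK /reflection -xE subrr.
by rewrite raddf0 addr0 subr0.
Qed.
End IdempotentEndomorphism.

Section Push.
Variables (M : comMonoidType) (A : system M).

Lemma cast_section (g : C0 A) a b (e : a = b) : cast e (g a) = g b.
Proof. by case: b / e. Qed.

(** When [r] absorbs into [c], the map [r_*] is an endomorphism of [A c]. Working
    with these endomorphisms of one fixed group turns the cocycle identities
    into equations without transports. *)
Definition push_in r c (e : (r * c)%g = c) (x : A c) : A c :=
  cast e (push A r c x).

Lemma push_in_zmod_morphism r c (e : (r * c)%g = c) :
  zmod_morphism (push_in e).
Proof. by move=> x y; rewrite /push_in pushB castB. Qed.

HB.instance Definition _ r c (e : (r * c)%g = c) :=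
  GRing.isZmodMorphism.Build (A c) (A c) (push_in e)
    (push_in_zmod_morphism e).

Lemma cast_push r c c' (e : c' = c) (rc : (r * c)%g = c)
    (e' : (r * c')%g = c) (x : A c') :
  cast e' (push A r c' x) = push_in rc (cast e x).
Proof.
by case: c / e rc e' => rc e'; rewrite /push_in cast_id; apply: cast_irr.
Qed.

Lemma push_in_comp r s c (ec : (r * c)%g = c) (es : (s * c)%g = c)
    (ers : (r * s * c)%g = c) x :
  push_in ers x = push_in ec (push_in es x).
Proof.
rewrite {1}/push_in pushM -(cast_push es ec (etrans (congr1 _ es) ec)).
exact: cast_trans.
Qed.
End Push.

Section Semilattice.
Variables (M : semilatticeType) (A : system M).
Implicit Types a b c : M.

Lemma push_in_idem r c (e : (r * c)%g = c) (x : A c) :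
  push_in e (push_in e x) = push_in e x.
Proof.
have e' : (r * r * c)%g = c by rewrite mulgg.
rewrite -(push_in_comp _ _ e'); case: _ / (esym (mulgg r)) e' => e'.
exact: cast_irr.
Qed.

Lemma D0_eq0 (g : C0 A) : d0 g = 0 -> g = 0.
Proof.
move=> g0; apply: functional_extensionality_dep => a.
have /(congr1 (cast (mulgg a))) : d0 g a a = 0 by rewrite g0.
rewrite /= /C1_fun /= /d0_fun castD castB raddf0.
rewrite cast_section (cast_comp (mulgC a a)) (cast_irr _ (mulgg a)) addrAC.
move/eqP; rewrite subr_eq0 => /eqP/esym.
exact: (doubled_eq0 (R := push_in (mulgg a)) (push_in_idem _)).
Qed.

Lemma mulg_absorb a b c : (a * b = c -> a * c = c)%g.
Proof. by move=> <-; rewrite mulgA mulgg. Qed.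

Section NormalizedCocycle.
Variable f : C1 A.
Hypotheses (f_cocycle : d1 f = 0) (f_diag : forall a, f a a = 0).

Lemma cocycleE a b c : 
  cast (mulgA a b c) (push A a (b * c)%g (f b c))
  + cast (mulgA a b c) (f a (b * c)%g)
  = f (a * b)%g c + cast (mulgC c (a * b)%g) (push A c (a * b)%g (f a b)).
Proof.
have : C2_val (d1 f) a b c = 0 by rewrite f_cocycle.
rewrite /= /d1_fun => /eqP.
by rewrite subr_eq0 addrAC subr_eq addrC => /eqP ->; rewrite addrC.
Qed.

(** This is the identity at [(a,a,b)], where the term [f(a,a)] drops out. The
    index [c] stands for [ab], kept general because the lemma is applied both
    to [(a,b)] and to [(b,a)] inside the same group. *)
Lemma cocycle_absorb a b c (e : (a * b)%g = c) (ac : (a * c)%g = c) :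
  cast ac (f a c) = cast e (f a b) - push_in ac (cast e (f a b)).
Proof.
case: c / e ac => ac; rewrite cast_id.
have e : (a * a * b)%g = (a * b)%g by rewrite mulgg.
have /(congr1 (cast e)) := cocycleE a a b.
rewrite f_diag !raddf0 addr0 castD !cast_comp.
rewrite (cast_push (erefl _) ac) -(C1_cast f (mulgg a) erefl e).
rewrite cast_id (cast_irr _ ac) => fE.
by rewrite -[X in _ = X - _]fE addrAC subrr add0r.
Qed.

Lemma normalized_cocycle_eq0 : f = 0.
Proof.
apply: val_inj; apply: functional_extensionality_dep => a.
apply: functional_extensionality_dep => b; rewrite -[LHS]/(f a b).
have ac : (a * (a * b))%g = (a * b)%g by exact: mulg_absorb erefl.
have bc : (b * (a * b))%g = (a * b)%g by exact: mulg_absorb (mulgC b a).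
(* At (a,b,ab) every term can be transported to A(ab); the remaining diagonal
   value f(ab,ab) is zero. *)
have e : (a * b * (a * b))%g = (a * b)%g := mulgg _.
have /(congr1 (cast e)) := cocycleE a b (a * b)%g.
rewrite f_diag add0r castD !cast_comp.
rewrite (cast_push bc ac) (cast_push (erefl _) e).
have -> : cast (etrans (mulgA a b (a * b)%g) e) (f a (b * (a * b))%g)
        = cast ac (f a (a * b)%g).
  rewrite (C1_cast f erefl bc (congr1 _ bc)) cast_comp; exact: cast_irr.
rewrite (cocycle_absorb (mulgC b a)) (cocycle_absorb (erefl _)) -C1P /=.
rewrite (raddfB (push_in ac)) /= -(push_in_comp _ _ e) addrC subrKA => /eqP.
rewrite subr_eq => /eqP.
exact: (doubled_eq0 (R := push_in e) (push_in_idem _)).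
Qed.
End NormalizedCocycle.

Lemma cocycle_is_coboundary (f : C1 A) : d1 f = 0 -> exists g, d0 g = f.
Proof.
move=> f0.
(* Any primitive g must satisfy (2 a_* - 1) g(a) = f(a,a), and 2 a_* - 1 is its
   own inverse. *)
pose g : C0 A := fun a =>
  reflection (push_in (mulgg a)) (cast (mulgg a) (f a a)).
exists g; apply/esym/eqP; rewrite -subr_eq0; apply/eqP.
apply: normalized_cocycle_eq0 => [|a]; first by rewrite raddfB /= f0 d1_d0 subr0.
apply: (can_inj (castK (mulgg a) (esym (mulgg a)))).
rewrite -[LHS]/(cast (mulgg a) (f a a - d0_fun g a a)) raddf0 castB.
apply/eqP; rewrite subr_eq0; apply/eqP; rewrite /d0_fun castD castB.
rewrite cast_section (cast_comp (mulgC a a)) (cast_irr _ (mulgg a)) addrAC.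
exact: (esym (reflectionK (R := push_in (mulgg a)) (push_in_idem _) _)).
Qed.

Section Splitting.
Variables (N : comMonoidType) (E : coextension A N).
Local Notation p := (coext_proj E).

Lemma coext_act_inj a (n : fiber p a) : injective (fun x : A a => coext_act x n).
Proof.
move=> x y xy; have [z [_ zP]] := coext_act_unique n (coext_act x n).
by rewrite -(zP x) // -(zP y).
Qed.

Lemma val_coext_act_cast a a' (e : a = a') (x : A a) (n : fiber p a)
    (n' : fiber p a') :
  val n = val n' -> val (coext_act x n) = val (coext_act (cast e x) n').
Proof. by case: a' / e n' => n' /val_inj ->; rewrite cast_id. Qed.

Lemma fiber_sq_proof a (n : fiber p a) : p (val n * val n)%g == a.
Proof. by rewrite gmulfM (eqP (valP n)) mulgg. Qed.

(** Since [aa = a], squaring maps the fiber over [a] to itself. *)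
Definition fiber_sq a (n : fiber p a) : fiber p a :=
  exist _ (val n * val n)%g (fiber_sq_proof n).

Lemma fiber_sq_act a (x : A a) (n : fiber p a) :
  fiber_sq (coext_act x n)
  = coext_act (push_in (mulgg a) x + push_in (mulgg a) x) (fiber_sq n).
Proof.
apply: val_inj.
rewrite -[LHS]/(val (fiber_mul (coext_act x n) (coext_act x n))).
rewrite coext_act_mul (@val_coext_act_cast _ _ (mulgg a) _ _ (fiber_sq n)) // castD.
by rewrite (cast_comp (mulgC a a)) (cast_irr _ (mulgg a)).
Qed.

(** With [fiber_sq n = u . n], idempotency of [x . n] is the equation
    [(2 a_* - 1) x = - u], which the involution [2 a_* - 1] solves uniquely. *)
Lemma fiber_idempotent a : exists! n : fiber p a, fiber_sq n = n.
Proof.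
have [n0 n0a] := coext_surj E a.
have {n0a} n : fiber p a by exists n0; apply/eqP.
have [u [uE _]] := coext_act_unique n (fiber_sq n).
pose R : {additive A a -> A a} := push_in (mulgg a).
have R_idem x : R (R x) = R x by exact: push_in_idem.
have idemE x : fiber_sq (coext_act x n) = coext_act x n <-> reflection R x = - u.
  rewrite fiber_sq_act uE -coext_actD /reflection -/(R x); split.
    by move/coext_act_inj => xE; rewrite -[X in _ - X]xE opprD addrA subrr sub0r.
  move/eqP; rewrite subr_eq [- u + x]addrC => /eqP xE; congr coext_act.
  by rewrite xE subrK.
exists (coext_act (reflection R (- u)) n); split.
  by apply/idemE; apply: reflectionK.
move=> n' n'_idem; have [x [xE _]] := coext_act_unique n n'.
move: n'_idem; rewrite xE => /idemE <-; congr coext_act.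
exact: reflectionK.
Qed.

Lemma coextension_splits_uniquely : splits_uniquely E.
Proof.
pose e a : fiber p a := projT1 (cid (fiber_idempotent a)).
have eP a : unique (fun n => fiber_sq n = n) (e a).
  exact: projT2 (cid (fiber_idempotent a)).
have e_uniq a n : p n = a -> (n * n)%g = n -> val (e a) = n.
  move=> /eqP pn nn; have [_ /(_ (exist _ n pn)) ->] := eP a => //.
  exact: val_inj.
have ee a : (val (e a) * val (e a))%g = val (e a).
  by have [/(congr1 val)] := eP a.
have pe a : p (val (e a)) = a by exact: (eqP (valP (e a))).
exists (fun a => val (e a)); split.
  split=> //; split=> [|a b]; first by apply: e_uniq; rewrite ?gmulf1 ?mulg1.
  apply: e_uniq; rewrite ?gmulfM ?pe //.
  by rewrite mulgA -(mulgA _ (val (e b))) (mulgC (val (e b))) !mulgA ee -mulgA ee.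
move=> mu [[mu1 muM] muK]; apply: functional_extensionality_dep => a.
by apply: e_uniq; rewrite -?muM ?mulgg.
Qed.
End Splitting.
End Semilattice.

Theorem theorem7p1 (M : semilatticeType) (A : system M) :
  (forall x : D0 A, x = 0) /\
  (forall x : D1 A, x = 0) /\
  (forall (N : comMonoidType) (E : coextension A N), splits_uniquely E).
Proof.
split=> [g|]; first by apply/val_inj/D0_eq0/eqP/(valP g).
split=> [|N E]; last exact: coextension_splits_uniquely.
elim/quotW => f; rewrite -[RHS](raddf0 (\pi_(D1 A))%qT).
apply/eqP; rewrite -Quotient.idealrBE subr0; apply/asboolP.
exact/cocycle_is_coboundary/eqP/(valP f).
Qed.
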